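(* Consider a budgeted causal bandit instance on a no-backdoor graph with $M$ binary intervenable nodes $X_1,\dots,X_M$, let $p_{i,x}=\mathbb{P}(X_i=x)$ and assume $p=\min_{i\in[M],x\in\{0,1\}}p_{i,x}>0$. Then the expected simple regret $E[r(B)]$ of the observational algorithm with budget $B$ is $$O\left(\sqrt{\frac{1}{pB}\log (pMB)}\right).$$
   Context: Setting. A causal Bayesian network is a directed acyclic graph $\mathcal{G}$ whose nodes are random variables with finite ranges, together with a joint distribution $\mathbb{P}$ factorizing over $\mathcal{G}$. The intervention $do(X=x)$ removes all edges from the parents of $X$ into $X$ and sets $X=x$; the empty intervention $do()$ (observation) samples from $\mathbb{P}$. There is a reward node $Y\in\{0,1\}$ and a set of intervenable nodes $X_1,\dots,X_M\in\{0,1\}$; when not intervened upon, $X_i\sim\mathrm{Bernoulli}(p_i)$, with $p_{i,1}=p_i$, $p_{i,0}=1-p_i$. The graph is a no-backdoor graph: there are no backdoor paths from any $X_i$ to $Y$, so that $E[Y\mid do(X_i=x)]=E[Y\mid X_i=x]$. Arms. $\mathcal{A}=\{a_{i,x}: i\in[M],x\in\{0,1\}\}\cup\{a_0\}$, where $a_{i,x}=do(X_i=x)$ has mean reward $\mu_{i,x}=E[Y\mid X_i=x]$, and $a_0=do()$ has mean reward $\mu_0=E[Y]$. Pulling $a_0$ costs $1$ and reveals an independent sample of the variables (in particular $X_1,\dots,X_M,Y$); pulling $a_{i,x}$ costs $\gamma\ge 1$. The total cost may not exceed the budget $B$. The distribution $\mathbb{P}$ is unknown to the algorithm. Observational algorithm.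 It plays $a_0$ for all $B$ rounds. With $X_i(t),Y_t$ the values sampled in round $t$, it computes the empirical means $\widehat\mu_0=\frac1B\sum_{t=1}^B Y_t$ and $\widehat{\mu}_{i,x}=\frac{\sum_{t=1}^B Y_t\mathbb{1}\{X_i(t)=x\}}{\sum_{t=1}^B\mathbb{1}\{X_i(t)=x\}}$, and outputs the arm $a_B\in\mathcal{A}$ with the highest empirical mean. Simple regret: $r(B)=\max_{a\in\mathcal{A}}\mu_a-\mu_{a_B}$; the expectation is over all randomness. *)

(* Defs.v *)
From mathcomp Require Import all_boot all_order all_algebra.
From mathcomp Require Import reals.

Set Implicit Arguments.
Unset Strict Implicit.
Unset Printing Implicit Defensive.

Import Order.TTheory GRing.Theory Num.Theory.
Local Open Scope ring_scope.

(* The range of node [v] is {0, ..., nval v - 1}; an assignment gives one value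
   to every node. *)
Notation assignment nval := {dffun forall v, 'I_(nval v)}.

(* [@mech v w c] is the conditional probability that node [v] takes the value [c]
   given its parents. It receives a whole assignment [w], but by [mech_local]
   it only reads the values of the parents of [v]. *)
Record causal_network (R : realType) (V : finType) (nval : V -> nat) := {
  edge : rel V;
  mech : forall v : V, assignment nval -> 'I_(nval v) -> R;
  acyclic : forall u v, edge u v -> ~~ connect edge v u;
  nval_gt0 : forall v, (0 < nval v)%N;
  mech_ge0 : forall v w (c : 'I_(nval v)), 0 <= mech w c;
  mech_sum1 : forall v w, \sum_(c : 'I_(nval v)) mech w c = 1;
  mech_local : forall v (w w' : assignment nval),
    (forall u, edge u v -> w u = w' u) -> @mech v w =1 @mech v w'
}.

Section Network.
Variables (R : realType) (V : finType) (nval : V -> nat).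
Implicit Types (N : causal_network R nval).

Definition joint N (w : assignment nval) : R := \prod_v mech N w (w v).

Section Do.
Variables (N : causal_network R nval) (v0 : V) (x : 'I_(nval v0)).

Let do_edge : rel V := fun u v => edge N u v && (v != v0).
Let do_mech (v : V) (w : assignment nval) (c : 'I_(nval v)) : R :=
  if v == v0 then (c == x :> nat)%:R else mech N w c.

Fact do_acyclic u v : do_edge u v -> ~~ connect do_edge v u.
Proof.
move=> /andP[/(acyclic) + _]; apply: contra.
by apply: connect_sub => a b /andP[eab _]; apply: connect1.
Qed.

Fact do_mech_ge0 v w c : 0 <= @do_mech v w c.
Proof. by rewrite /do_mech; case: ifP => _; rewrite ?ler0n ?mech_ge0. Qed.

Fact do_mech_sum1 v w : \sum_(c : 'I_(nval v)) @do_mech v w c = 1.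
Proof.
rewrite /do_mech; case: eqVneq => [->|_]; last exact: mech_sum1.
by rewrite (bigD1 x) //= eqxx big1 ?addr0 // => c /negPf; rewrite -val_eqE => ->.
Qed.

Fact do_mech_local v (w w' : assignment nval) :
  (forall u, do_edge u v -> w u = w' u) -> @do_mech v w =1 @do_mech v w'.
Proof.
rewrite /do_edge /do_mech => eq_ww' c; case: eqVneq eq_ww' => // _ eq_ww'.
by apply: mech_local => u euv; apply: eq_ww'; rewrite euv.
Qed.

Definition do_network : causal_network R nval :=
  Build_causal_network do_acyclic (nval_gt0 N) do_mech_ge0 do_mech_sum1
    do_mech_local.

End Do.

(* The path has no repeated nodes, ignores the orientation of the edges except
   that the first one points into [x], and may contain colliders. *)
Definition backdoor_path N (x y : V) (p : seq V) : bool :=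
  [&& path (fun u v => edge N u v || edge N v u) x p, uniq (x :: p),
      last x p == y & if p is z :: _ then edge N z x else false].

End Network.

Record causal_bandit (R : realType) (M : nat) := {
  node : finType;
  nval : node -> nat;
  network : causal_network R nval;
  X : 'I_M -> node;
  Y : node;
  gamma : R;
  X_inj : injective X;
  X_neqY : forall i, X i != Y;
  X_binary : forall i, nval (X i) = 2;
  Y_binary : nval Y = 2;
  no_backdoor : forall i p, ~~ backdoor_path network (X i) Y p;
  gamma_ge1 : 1 <= gamma
}.

Arguments node {R M} c.
Arguments nval {R M} c v.

Notation sample I := (assignment (nval I)).
Notation history I T := {ffun 'I_T -> sample I}.

(* [None] is the arm a_0 = do(); [Some (i, x)] is the arm do(X_i = x). *)
Definition arm (M : nat) := option ('I_M * bool).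

Section Bandit.
Variables (R : realType) (M : nat) (I : causal_bandit R M).

Definition cost (a : arm M) : R := if a is Some _ then gamma I else 1.

Fact bool_in_range (i : 'I_M) (x : bool) : (x < nval I (X I i))%N.
Proof. by rewrite X_binary; case: x. Qed.

Definition arm_network (a : arm M) : causal_network R (nval I) :=
  match a with
  | None => network I
  | Some (i, x) => do_network (network I) (Ordinal (bool_in_range i x))
  end.

Definition reward (w : sample I) : R := (w (Y I) : nat)%:R.

(* For a = do(X_i = x) this is E[Y | do(X_i = x)], which the absence of backdoor
   paths makes equal to E[Y | X_i = x]. *)
Definition mu (a : arm M) : R :=
  \sum_(w : sample I) joint (arm_network a) w * reward w.

Definition prX (i : 'I_M) (x : bool) : R :=
  \sum_(w : sample I | w (X I i) == x :> nat) joint (network I) w.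

(* The default value 1 only matters when M = 0. *)
Definition pmin : R := \big[Num.min/1]_(ix : 'I_M * bool) prX ix.1 ix.2.

Section Play.
Variable T : nat.

(* Independent samples, the one of round [t] being drawn under arm [s t]. *)
Definition history_law (s : 'I_T -> arm M) (h : history I T) : R :=
  \prod_t joint (arm_network (s t)) (h t).

Definition total_cost (s : 'I_T -> arm M) : R := \sum_t cost (s t).

Definition observe : 'I_T -> arm M := fun=> None.

Lemma total_cost_observe : total_cost observe = T%:R.
Proof. by rewrite /total_cost sumr_const card_ord. Qed.

Definition nX (h : history I T) (i : 'I_M) (x : bool) : nat :=
  #|[set t | h t (X I i) == x :> nat]|.

(* [d] is the value given to the empirical mean of an arm do(X_i = x) when the
   event X_i = x was never observed. *)
Definition mu_hat (d : R) (h : history I T) (a : arm M) : R :=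
  match a with
  | None => (\sum_t reward (h t)) / T%:R
  | Some (i, x) =>
      if nX h i x == 0%N then d
      else (\sum_(t | h t (X I i) == x :> nat) reward (h t)) / (nX h i x)%:R
  end.

(* Ties may be broken in any way, possibly depending on the history. *)
Definition highest_empirical_mean (d : R) (out : history I T -> arm M) : Prop :=
  forall h a, mu_hat d h a <= mu_hat d h (out h).

Definition simple_regret (a : arm M) : R :=
  (\big[Num.max/mu None]_(b : arm M) mu b) - mu a.

Definition expected_regret (out : history I T -> arm M) : R :=
  \sum_(h : history I T) history_law observe h * simple_regret (out h).

End Play.
End Bandit.

(* Main.v *)
Require Import Defs.
From HB Require Import structures.
From mathcomp Require Import all_boot all_order all_algebra.
From mathcomp Require Import all_classical all_reals all_analysis.
From mathcomp Require Import ring lra.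

Set Implicit Arguments.
Unset Strict Implicit.
Unset Printing Implicit Defensive.

Import Order.TTheory GRing.Theory Num.Theory.
Local Open Scope ring_scope.

(* Without backdoor paths, E[Y | do(X_i = x)] = E[Y | X_i = x], so for each arm
   the sum over the rounds of 1{X_i(t) = x} (Y_t - mu - eps) has independent
   terms of negative mean. For lambda = eps / 16 each factor of its exponential
   moment is at most exp(- p_{i,x} eps^2 / 32): the number of observations of
   X_i = x need not be controlled separately. A union bound over the 2M + 1 arms
   and the two signs gives, for eps <= 1,
     E[r(B)] <= 2 eps + (4M + 2) exp(- p B eps^2 / 32).
   Take eps^2 = 64 ln(pMB) / (pB); the last term is then at most
   6M / (pMB)^2 <= 6 / (pB), which is O(eps) because ln(pMB) >= ln kappa > 0.
   If eps > 1 the bound is trivial. *)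

(** * Sums over the values on a block of nodes, all other values being frozen *)

Section Agreement.
Variables (R : realType) (V : finType) (nval : V -> nat).
Implicit Types (S T : {set V}) (w : assignment nval).

(** Mostly used as [agree (~: S) w w0]: the block [S] is free, every other node is frozen at [w0].
    This replaces a type of partial assignments. *)
Definition agree S w w' : bool := [forall v in S, w v == w' v].

Lemma agreeP S w w' : reflect {in S, forall v, w v = w' v} (agree S w w').
Proof. exact: 'forall_in_eqP. Qed.

Definition merge S w w' : assignment nval :=
  [ffun v => if v \in S then w v else w' v].

Definition update w v (c : 'I_(nval v)) : assignment nval :=
  [ffun u => dfwith w v c u].

(** Fubini: the outer sum fills [S], the inner one [T]. *)
Lemma sum_agreeU S T w0 (F : assignment nval -> R) : [disjoint S & T] ->
  \sum_(w | agree (~: (S :|: T)) w w0) F w =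
  \sum_(w | agree (~: S) w w0) \sum_(w' | agree (~: T) w' w) F w'.
Proof.
move=> dST.
rewrite (partition_big (fun w => merge S w w0)
  (fun w => agree (~: S) w w0)) /=; last first.
  by move=> w _; apply/agreeP => v; rewrite inE ffunE => /negPf->.
apply: eq_bigr => w /agreeP ww0; apply: eq_bigl => w'.
apply/andP/agreeP => [[/agreeP w'w0 /eqP <-] v|w'w].
  rewrite !inE ffunE => vT; case: ifPn => // vS.
  by apply: w'w0; rewrite !inE negb_or vS.
split.
  apply/agreeP => v; rewrite !inE negb_or => /andP[vS vT].
  by rewrite w'w ?inE // ww0 ?inE.
apply/eqP/ffunP => v; rewrite ffunE; case: ifPn => vS; last by rewrite ww0 ?inE.
by rewrite w'w // inE (disjointFr dST).
Qed.

Lemma sum_agree1 v w0 (F : 'I_(nval v) -> R) :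
  \sum_(w | agree (~: [set v]) w w0) F (w v) = \sum_c F c.
Proof.
rewrite (reindex (update w0 (v := v))) /=; last first.
  exists (fun w : assignment nval => w v) => [c _|w].
    by rewrite ffunE dfwithin.
  rewrite inE => /agreeP ww0; apply/ffunP => u; rewrite ffunE.
  have [<-|uv] := eqVneq v u; first by rewrite dfwithin.
  by rewrite dfwithout // ww0 // !inE eq_sym.
apply: eq_big => [c|c _]; last by rewrite ffunE dfwithin.
by apply/agreeP => u; rewrite !inE ffunE => uv; rewrite dfwithout // eq_sym.
Qed.

(** Independence of disjoint blocks: [G] does not read [T] and [H] does not read [S]. *)
Lemma sum_agree_mul S T w0 (G H : assignment nval -> R) : [disjoint S & T] ->
  (forall w w', agree (~: T) w w' -> G w = G w') ->
  (forall w w', agree (~: S) w w' -> H w = H w') ->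
  \sum_(w | agree (~: (S :|: T)) w w0) G w * H w =
  (\sum_(w | agree (~: S) w w0) G w) * (\sum_(w | agree (~: T) w w0) H w).
Proof.
move=> dST GT HS; rewrite sum_agreeU // big_distrl /=.
apply: eq_bigr => w /agreeP ww0.
transitivity (G w * \sum_(w' | agree (~: T) w' w) H w').
  by rewrite big_distrr; apply: eq_bigr => w' /GT->.
congr (_ * _).
(* Under the inner sum the values on [S] are moved from [w] to [w0], a change that [H] does not
   see. *)
rewrite (reindex_onto (fun w' => merge T w' w) (fun w' => merge T w' w0)) /=; last first.
  move=> w' /agreeP w'w; apply/ffunP => v; rewrite !ffunE.
  have [//|vT] := boolP (v \in T).
  by rewrite w'w // inE.
have mergeT w' : agree (~: T) (merge T w' w) w && (merge T (merge T w' w) w0 == w')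
    = agree (~: T) w' w0.
  apply/andP/agreeP => [[_ /eqP<-] v|w'w0].
    by rewrite !inE ffunE => /negPf->.
  split; first by apply/agreeP => v; rewrite inE ffunE => /negPf->.
  apply/eqP/ffunP => v; rewrite !ffunE; have [//|vT] := boolP (v \in T).
  by rewrite w'w0 ?inE.
apply: eq_big => // w'; rewrite mergeT => /agreeP w'w0.
apply: HS; apply/agreeP => v vS; rewrite ffunE; case: ifPn => // vT.
by rewrite ww0 // w'w0 // inE.
Qed.

End Agreement.

(** * Total mass of a network, by peeling off sinks *)

Section Normalization.
Variables (R : realType) (V : finType) (nval : V -> nat).
Implicit Types (N : causal_network R nval) (S : {set V}) (w : assignment nval).

Lemma edge_irr N v : edge N v v = false.
Proof. by apply/negP => /[dup] /acyclic; rewrite connect0. Qed.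

(** A node of [S] that reaches the fewest nodes works: by acyclicity, a successor in [S] would reach
    strictly fewer. *)
Lemma sinkP N S v0 : v0 \in S ->
  exists2 v, v \in S & forall u, u \in S -> ~~ edge N v u.
Proof.
move=> v0S.
case: (arg_minnP (fun v => #|[set u | connect (edge N) v u]|) v0S) => v vS vmin.
exists v => // u uS; apply/negP => vu; have := vmin _ uS.
rewrite leqNgt => /negP; apply; apply: proper_card; apply/properP; split.
  apply/fintype.subsetP => z; rewrite !inE; exact/connect_trans/connect1.
by exists v; rewrite inE ?connect0 // (acyclic vu).
Qed.

(** Induction on [#|S|]: a sink of [S] is read by no mechanism in [S], so its own mechanism can be
    summed first, to 1. *)
Lemma sum_mech N S w0 :
  \sum_(w | agree (~: S) w w0) \prod_(v in S) mech N w (w v) = 1.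
Proof.
have [n] := ubnP #|S|; elim: n => // n IH in S w0 *; rewrite ltnS => Sn.
have [->|[v0 v0S]] := set_0Vmem S.
  rewrite (big_pred1 w0) ?big_set0 // => w /=.
  apply/agreeP/eqP => [ww0|-> //]; apply/ffunP => v.
  by rewrite ww0 // !inE.
have [v vS vsink] := sinkP N v0S.
have eqS : S = (S :\ v) :|: [set v] by rewrite finset.setUC finset.setD1K.
have dS : [disjoint S :\ v & [set v]].
  by rewrite disjoint_sym disjoints1 !inE eqxx.
rewrite {1}eqS sum_agreeU //.
rewrite -[RHS](IH (S :\ v) w0); last by move: Sn; rewrite (cardsD1 v) vS.
apply: eq_bigr => w _.
transitivity (\prod_(u in S :\ v) mech N w (w u) * \sum_c @mech _ _ _ N v w c).
  2: by rewrite mech_sum1 mulr1.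
rewrite -(sum_agree1 w) big_distrr /=.
apply: eq_bigr => w' /agreeP w'w; rewrite (big_setD1 v) //= mulrC; congr (_ * _).
  apply: eq_bigr => u; rewrite !inE => /andP[uv uS]; rewrite w'w ?inE //.
  apply: mech_local => z zu; apply: w'w; rewrite !inE.
  by apply: contraTneq zu => ->; exact: vsink.
apply: mech_local => z zv; apply: w'w; rewrite !inE.
by apply: contraTneq zv => ->; rewrite edge_irr.
Qed.

Lemma joint_ge0 N w : 0 <= joint N w.
Proof. by apply: prodr_ge0 => v _; apply: mech_ge0. Qed.

Lemma sum_joint N : \sum_w joint N w = 1.
Proof.
pose w0 : assignment nval := [ffun v => Ordinal (nval_gt0 N v)].
rewrite -[RHS](sum_mech N finset.setT w0); apply: eq_big => w.
  by apply/esym/agreeP => v; rewrite !inE.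
by move=> _; apply: eq_bigl => v; rewrite inE.
Qed.

End Normalization.

(** * Conditioning equals intervention in the absence of backdoor paths *)

Section NoBackdoor.
Variables (R : realType) (V : finType) (nval : V -> nat).
Variables (N : causal_network R nval) (x y : V).
Hypothesis no_backdoor_xy : forall p, ~~ backdoor_path N x y p.

Let adj u v := edge N u v || edge N v u.

(** [D] collects the nodes joined to a parent of [x] by a walk, of any orientation, that avoids [x].
    If [y] were among them, that walk, shortened to a simple path and started from [x], would be a
    backdoor path. *)
Lemma backdoor_component : exists D : {set V},
  [/\ x \notin D, y \notin D, forall z, edge N z x -> z \in D
    & forall u v, adj u v -> v != x -> u \in D -> v \in D].
Proof.
pose adj_off u v := [&& u != x, v != x & adj u v].
pose D := [set u | [exists z, edge N z x && connect adj_off z u]].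
have xND : x \notin D.
  rewrite inE; apply/existsP => -[z /andP[zx /connectP[p]]].
  elim/last_ind: p => [_ /= xz|p u _]; first by rewrite -xz edge_irr in zx.
  by rewrite rcons_path last_rcons => /andP[_ /and3P[_ ux _]] xu; rewrite xu eqxx in ux.
exists D; split=> // [|z zx|u v uv vx uD].
- rewrite inE; apply/existsP => -[z /andP[zx /connectP[p0 p0path]]].
  case/shortenP: p0path => p zp puniq _ ylast.
  have /negP[] := no_backdoor_xy (z :: p); apply/and4P; split=> //.
  + rewrite /= zx orbT /=; apply: sub_path zp => u v /and3P[_ _]; exact.
  + rewrite cons_uniq puniq andbT inE negb_or.
    have -> /= : x != z by apply: contraTneq zx => <-; rewrite edge_irr.
    clear zx puniq ylast; elim: p z zp => //= u p IH z /andP[/and3P[_ ux _] up].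
    by rewrite inE negb_or eq_sym ux (IH u).
  + by rewrite ylast.
- by rewrite inE; apply/existsP; exists z; rewrite zx connect0.
have ux : u != x by apply: contraNneq xND => <-.
move: uD; rewrite !inE => /existsP[z /andP[zx zu]]; apply/existsP; exists z.
by rewrite zx (connect_trans zu) // connect1 // /adj_off ux vx.
Qed.

(* Let [A := ~: D :\ x] with [D] from [backdoor_component]. The parents of [x]
   lie in [D] and no edge joins [D] to [A], so the blocks [D] and [A] are
   independent given the value of [x]. *)
Lemma no_backdoor_mul (c : 'I_(nval x)) (g : 'I_(nval y) -> R) :
  \sum_(w : assignment nval | w x == c) joint N w * g (w y) =
  (\sum_(w : assignment nval | w x == c) joint N w) *
    (\sum_w joint (do_network N c) w * g (w y)).
Proof.
have [D [xND yND parent_D adj_D]] := backdoor_component.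
pose A := ~: D :\ x.
pose w0 : assignment nval := [ffun v => dfwith (fun v => Ordinal (nval_gt0 N v)) x c v].
have w0x : w0 x = c by rewrite ffunE dfwithin.
have xD := negPf xND.
have dDA : [disjoint D & A].
  rewrite disjoint_sym finset.disjoints_subset.
  by apply/fintype.subsetP => v; rewrite !inE => /andP[].
(* [D], [A] and [x] exhaust the nodes, so only the value of [w0] at [x] matters. *)
have agree_x (w : assignment nval) : (w x == c) = agree (~: (D :|: A)) w w0.
  apply/eqP/agreeP => [wx v|]; last by rewrite -w0x; apply; rewrite !inE eqxx xD.
  by rewrite !inE; case: eqVneq => [->|]; rewrite ?wx ?w0x //= orbN.
(* Stated for any network because it serves for both [N] and [do_network N c]. *)
have joint_split (N' : causal_network R nval) (w : assignment nval) : joint N' w =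
    (\prod_(v in D) mech N' w (w v) * mech N' w (w x)) * \prod_(v in A) mech N' w (w v).
  rewrite /joint (bigD1 x) //= [_ * mech _ _ _]mulrC -mulrA; congr (_ * _).
  rewrite (bigID (mem D)) /=; congr (_ * _); apply: eq_bigl => v.
    by case: eqVneq => //= ->.
  by rewrite !inE.
pose PD (w : assignment nval) := \prod_(v in D) mech N w (w v).
pose PA (w : assignment nval) := \prod_(v in A) mech N w (w v).
(* A parent of a node of [D] is in [D] or is [x], and a parent of a node of [A] is not in [D]:
   neither block reads the other. *)
have mechD v (w w' : assignment nval) : v \in D -> agree (~: A) w w' ->
    mech N w (w v) = mech N w' (w' v).
  move=> vD /agreeP ww'; rewrite ww'; last by rewrite !inE negb_and negbK vD orbT.
  apply: mech_local => u uv; apply: ww'; rewrite !inE negb_and !negbK.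
  case: eqVneq => //= ux; apply: adj_D vD => //; exact/orP/or_intror.
have mechA v (w w' : assignment nval) : v \in A -> agree (~: D) w w' ->
    mech N w (w v) = mech N w' (w' v).
  rewrite !inE => /andP[vx vD] /agreeP ww'; rewrite ww' ?inE //.
  apply: mech_local => u uv; apply: ww'; rewrite inE; apply: contra vD.
  apply: adj_D => //; exact/orP/or_introl.
have mechx (w w' : assignment nval) : agree (~: A) w w' ->
    mech N w (w x) = mech N w' (w' x).
  move=> /agreeP ww'; rewrite ww' ?inE ?eqxx //.
  apply: mech_local => u /parent_D uD; apply: ww'.
  by rewrite !inE negb_and !negbK uD orbT.
have PDA (w w' : assignment nval) : agree (~: A) w w' -> PD w = PD w'.
  by move=> ww'; apply: eq_bigr => v vD; apply: mechD.
have PAD (w w' : assignment nval) : agree (~: D) w w' -> PA w = PA w'.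
  by move=> ww'; apply: eq_bigr => v vD; apply: mechA.
have gD (w w' : assignment nval) : agree (~: D) w w' -> g (w y) = g (w' y).
  by move=> /agreeP->; rewrite ?inE.
have PDxA (w w' : assignment nval) : agree (~: A) w w' ->
    PD w * mech N w (w x) = PD w' * mech N w' (w' x).
  by move=> ww'; rewrite (PDA _ _ ww') (mechx _ _ ww').
have PAgD (w w' : assignment nval) : agree (~: D) w w' ->
    PA w * g (w y) = PA w' * g (w' y).
  by move=> ww'; rewrite (PAD _ _ ww') (gD _ _ ww').
(* Block [A] sums out to 1. *)
have -> : \sum_(w : assignment nval | w x == c) joint N w =
    \sum_(w | agree (~: D) w w0) PD w * mech N w (w x).
  rewrite (eq_bigl _ _ agree_x) (eq_bigr _ (fun w _ => joint_split N w)).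
  by rewrite sum_agree_mul // sum_mech mulr1.
rewrite (eq_bigl _ _ agree_x).
under eq_bigr do rewrite joint_split -mulrA.
rewrite sum_agree_mul //; congr (_ * _).
(* Under the intervention all mass lies on [w x == c] and the mechanism of [x] is 1 there; block [D]
   then sums out to 1. *)
rewrite [RHS](bigID (fun w : assignment nval => w x == c)) /=.
rewrite [X in _ = _ + X]big1 ?addr0; last first.
  move=> w wx; rewrite joint_split /= eqxx.
  by rewrite val_eqE (negPf wx) mulr0 !mul0r.
transitivity (\sum_(w | agree (~: (D :|: A)) w w0) PD w * (PA w * g (w y))).
  by rewrite sum_agree_mul // sum_mech mul1r.
rewrite (eq_bigl _ _ agree_x); apply: eq_bigr => w.
rewrite -agree_x => /eqP wx; rewrite joint_split /= eqxx wx eqxx mulr1 mulrA.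
congr (_ * _ * _); apply: eq_bigr => v; case: eqVneq => // ->.
  by rewrite xD.
by rewrite !inE eqxx.
Qed.

End NoBackdoor.

(** * Chernoff bound for a function centered on an event *)

Section Concentration.
Variables (R : realType) (W : finType) (P : W -> R).
Hypotheses (P_ge0 : forall w, 0 <= P w) (P_sum1 : \sum_w P w = 1).
Variables (A : pred W) (f : W -> R) (eps : R).
Hypotheses (f_le1 : forall w, `|f w| <= 1) (f_centered : \sum_(w | A w) P w * f w = 0).
Hypotheses (eps_ge0 : 0 <= eps) (eps_le1 : eps <= 1).

(** Multiplying by exp(-u) >= 1 - u reduces the claim to u^2 (1 - 2u) >= 0. *)
Lemma expR_le_quadratic (u : R) : `|u| <= 2^-1 -> expR u <= 1 + u + 2 * u ^+ 2.
Proof.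
rewrite ler_norml => /andP[u1 u2].
have e0 : 0 < expR (- u) := expR_gt0 _.
have e1 : 1 - u <= expR (- u) := expR_ge1Dx _.
have eK : expR u * expR (- u) = 1 by rewrite -expRD subrr expR0.
suff : 1 <= (1 + u + 2 * u ^+ 2) * expR (- u) by rewrite -{1}eK ler_pM2r.
have q0 : 0 <= 1 + u + 2 * u ^+ 2 by nra.
apply: le_trans (ler_wpM2l q0 e1); nra.
Qed.

(** Vanishes off [A], so a round outside [A] contributes a factor 1 to the exponential. *)
Let Z w : R := (A w)%:R * (f w - eps).
Let q : R := \sum_(w | A w) P w.

(** The drift - q eps and the bound 4 q on the second moment are both proportional to [q]; at scale
    eps / 16 the expansion gives 1 - q eps^2 / 16 + q eps^2 / 32. *)
Lemma mgf_le : \sum_w P w * expR (eps / 16 * Z w) <= expR (- (q * eps ^+ 2 / 32)).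
Proof.
move: (eps_ge0) (eps_le1) => e0 e1.
have ZE : \sum_w P w * Z w = - (q * eps).
  rewrite /q mulr_suml -sumrN.
  transitivity (\sum_(w | A w) (P w * f w - P w * eps)).
    rewrite [RHS]big_mkcond; apply: eq_bigr => w _; rewrite /Z.
    by case: (A w); rewrite ?mul1r ?mul0r ?mulr0 ?mulrBr.
  by rewrite big_split /= f_centered add0r.
have Z2E : \sum_w P w * Z w ^+ 2 <= 4 * q.
  rewrite /q mulr_sumr [X in _ <= X]big_mkcond /=; apply: ler_sum => w _.
  rewrite /Z; case: (A w); last by rewrite mul0r expr0n mulr0.
  rewrite mul1r mulrC; apply: ler_wpM2r => //.
  have := f_le1 w; rewrite ler_norml => /andP[f1 f2].
  have z1 : 0 <= 2 - (f w - eps) by lra.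
  have z2 : 0 <= 2 + (f w - eps) by lra.
  by have := mulr_ge0 z1 z2; lra.
apply: le_trans (expR_ge1Dx _).
apply: (@le_trans _ _ (\sum_w P w * (1 + eps / 16 * Z w + 2 * (eps / 16 * Z w) ^+ 2))).
  apply: ler_sum => w _; apply: ler_wpM2l => //; apply: expR_le_quadratic.
  rewrite /Z; case: (A w); last by rewrite mul0r mulr0 normr0.
  by have := f_le1 w; rewrite mul1r !ler_norml => /andP[f1 f2]; apply/andP; split; nra.
have -> : \sum_w P w * (1 + eps / 16 * Z w + 2 * (eps / 16 * Z w) ^+ 2) =
    1 + eps / 16 * (\sum_w P w * Z w) + eps ^+ 2 / 128 * (\sum_w P w * Z w ^+ 2).
  rewrite -[X in _ = X + _ + _]P_sum1 !mulr_sumr -!big_split /=.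
  by apply: eq_bigr => w _; field.
have := ler_wpM2l (sqr_ge0 eps) Z2E; rewrite ZE; lra.
Qed.

(** Markov's inequality for the exponential of the sum, whose expectation is a [B]-th power by
    independence. *)
Lemma tail_le (B : nat) :
  \sum_(h : {ffun 'I_B -> W} | 0 <= \sum_t Z (h t)) \prod_t P (h t) <=
  expR (- (B%:R * q * eps ^+ 2 / 32)).
Proof.
have -> : - (B%:R * q * eps ^+ 2 / 32) = B%:R * - (q * eps ^+ 2 / 32) by ring.
rewrite expRM_natl; apply: le_trans (lerXn2r B _ _ mgf_le);
  rewrite ?nnegrE ?expR_ge0 //; last first.
  by apply: sumr_ge0 => w _; rewrite mulr_ge0 ?expR_ge0.
rewrite -[X in _ ^+ X](card_ord B) -prodr_const bigA_distr_bigA /=.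
rewrite [X in _ <= X](bigID (fun h : {ffun 'I_B -> W} => 0 <= \sum_t Z (h t))) /=.
apply: ler_wpDr.
  by apply: sumr_ge0 => h _; apply: prodr_ge0 => t _; rewrite mulr_ge0 ?expR_ge0.
apply: ler_sum => h Zh; rewrite big_split /= -expR_sum -mulr_sumr.
apply: ler_peMr; first exact: prodr_ge0.
by rewrite -expR0 ler_expR mulr_ge0 // divr_ge0.
Qed.

End Concentration.

(** * Regret of the observational algorithm at a fixed accuracy *)

Section Bandit.
Variables (R : realType) (M : nat) (I : causal_bandit R M).
Implicit Types (a : arm M) (w : sample I).

(** Selects the rounds entering the empirical mean of [a], so that one argument covers both kinds of
    arms. *)
Definition counted a w : bool :=
  if a is Some (i, x) then w (X I i) == x :> nat else true.

Lemma reward_ge0 w : 0 <= reward w.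
Proof. exact: ler0n. Qed.

Lemma reward_le1 w : reward w <= 1.
Proof. by rewrite lern1 -ltnS -[X in (_ < X)%N](Y_binary I) ltn_ord. Qed.

Lemma mu_ge0 a : 0 <= mu I a.
Proof. by apply: sumr_ge0 => w _; rewrite mulr_ge0 ?joint_ge0 ?reward_ge0. Qed.

Lemma mu_le1 a : mu I a <= 1.
Proof.
rewrite -(sum_joint (arm_network I a)); apply: ler_sum => w _.
by rewrite ler_piMr ?joint_ge0 ?reward_le1.
Qed.

(** The no-backdoor assumption enters here: it makes the interventional mean a conditional mean
    given the counted event. *)
Lemma reward_centered a :
  \sum_(w | counted a w) joint (network I) w * (reward w - mu I a) = 0.
Proof.
under eq_bigr do rewrite mulrBr; rewrite sumrB -mulr_suml; apply/eqP; rewrite subr_eq0.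
case: a => [[i x]|]; last by rewrite sum_joint mul1r.
apply/eqP; rewrite /mu /=.
exact: (no_backdoor_mul (no_backdoor (c := I) i)
  (Ordinal (bool_in_range I i x)) (fun c => (c : nat)%:R)).
Qed.

Lemma pmin_le_counted a : pmin I <= \sum_(w | counted a w) joint (network I) w.
Proof.
case: a => [[i x]|]; last by rewrite sum_joint bigmin_le_id.
exact: (bigmin_le _ (i, x) (fun ix : 'I_M * bool => prX I ix.1 ix.2)).
Qed.

Lemma simple_regret_le a (e : R) :
  (forall b, mu I b <= mu I a + e) -> simple_regret I a <= e.
Proof. by move=> le_e; rewrite lerBlDl; apply: bigmax_le. Qed.

Lemma simple_regret_le1 a : simple_regret I a <= 1.
Proof.
apply: simple_regret_le => b; apply: le_trans (mu_le1 b) _.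
by rewrite lerDr mu_ge0.
Qed.

Lemma history_law_ge0 B (h : history I B) : 0 <= history_law (@observe M B) h.
Proof. by apply: prodr_ge0 => t _; apply: joint_ge0. Qed.

Lemma sum_history_law B :
  \sum_(h : history I B) history_law (@observe M B) h = 1.
Proof.
rewrite -(bigA_distr_bigA (fun _ w => joint (network I) w)) sum_joint.
by rewrite prodr_const expr1n.
Qed.

Section Play.
Variables (B : nat) (eps : R).
Implicit Types (h : history I B).

(* This event contains the histories in which no sample is counted, so its
   complement also rules out the default value of the empirical mean. *)
Definition deviates a (s : bool) h : bool :=
  0 <= \sum_t (counted a (h t))%:R * ((-1) ^+ s * (reward (h t) - mu I a) - eps).

Lemma deviates_le a s : 0 <= eps -> eps <= 1 -> 0 <= pmin I ->
  \sum_(h | deviates a s h) history_law (@observe M B) h <=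
  expR (- (B%:R * pmin I * eps ^+ 2 / 32)).
Proof.
move=> eps0 eps1 p0; rewrite /history_law /=.
pose f w := (-1) ^+ s * (reward w - mu I a).
have f_le1 w : `|f w| <= 1.
  rewrite normrM normrX normrN1 expr1n mul1r ler_norml.
  have := reward_ge0 w; have := reward_le1 w; have := mu_ge0 a; have := mu_le1 a.
  by move=> ? ? ? ?; apply/andP; split; lra.
have f_centered : \sum_(w | counted a w) joint (network I) w * f w = 0.
  by under eq_bigr do rewrite mulrCA; rewrite -mulr_sumr reward_centered mulr0.
apply: le_trans (tail_le (joint_ge0 _) (sum_joint _) f_le1 f_centered eps0 eps1 B) _.
rewrite ler_expR lerN2 ler_wpM2r ?invr_ge0 // ler_wpM2r ?sqr_ge0 //.
by rewrite ler_wpM2l ?pmin_le_counted.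
Qed.

(** The two signs give two strict inequalities, which are divided by the number of counted
    rounds. *)
Lemma mu_hat_close d h a : (forall s, ~~ deviates a s h) ->
  `|mu_hat d h a - mu I a| < eps.
Proof.
move=> ndev.
pose n := #|[set t | counted a (h t)]|.
pose S := \sum_(t | counted a (h t)) reward (h t).
have sumE (s : bool) :
    \sum_t (counted a (h t))%:R * ((-1) ^+ s * (reward (h t) - mu I a) - eps) =
    (-1) ^+ s * (S - n%:R * mu I a) - n%:R * eps.
  rewrite /S /n -sum1_card natr_sum [in RHS]big_mkcond /=.
  rewrite [in X in X * mu I a]big_mkcond /=.
  rewrite [X in _ - X * eps]big_mkcond /= !mulr_suml -sumrB mulr_sumr -sumrB.
  by apply: eq_bigr => t _; rewrite inE; case: (counted _ _) => /=; ring.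
have lt0 (s : bool) : (-1) ^+ s * (S - n%:R * mu I a) - n%:R * eps < 0.
  by rewrite -sumE ltNge; exact: ndev.
have n_gt0 : (0 < n)%N.
  rewrite lt0n; apply/eqP => n0; have := lt0 false; apply/negP.
  rewrite /S n0 big_pred0 ?expr0 ?mul0r ?subr0 ?mul1r ?ltxx // => t.
  by have /eqP := n0; rewrite cards_eq0 => /eqP/setP/(_ t); rewrite !inE.
have -> : mu_hat d h a = S / n%:R.
  case: a @n @S {ndev sumE lt0} n_gt0 => [[i x]|] n S n_gt0 /=.
    by rewrite ifN // -lt0n.
  rewrite /S /n; congr (_ / _%:R); rewrite -[LHS]card_ord.
  by apply: eq_card => t; rewrite inE.
have n0 : 0 < n%:R :> R by rewrite ltr0n.
have -> : S / n%:R - mu I a = (S - n%:R * mu I a) / n%:R by field; rewrite gt_eqF.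
rewrite normrM normfV (gtr0_norm n0) ltr_pdivrMr // ltr_norml.
have := lt0 false; have := lt0 true; rewrite expr0 expr1 => ? ?.
by apply/andP; split; lra.
Qed.

Lemma expected_regret_le d (out : history I B -> arm M) :
  highest_empirical_mean d out -> 0 <= eps -> eps <= 1 -> 0 <= pmin I ->
  expected_regret out <=
    2 * eps + (4 * M%:R + 2) * expR (- (B%:R * pmin I * eps ^+ 2 / 32)).
Proof.
move=> outP eps0 eps1 p0.
(* If some deviation occurs, its indicator alone dominates the regret, which is at most 1. Otherwise
   every empirical mean is within [eps], and passing from true to empirical means and back costs 2
   eps. *)
have regret_le h : simple_regret I (out h) <=
    2 * eps + \sum_(k : arm M * bool) (deviates k.1 k.2 h)%:R.
  have [/existsP[k dev]|/existsPn ndev] :=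
      boolP [exists k : arm M * bool, deviates k.1 k.2 h].
    apply: le_trans (simple_regret_le1 _) _; rewrite (bigD1 k) //= dev.
    by rewrite addrCA lerDl addr_ge0 ?mulr_ge0 // sumr_ge0.
  rewrite big1 ?addr0 => [|k _]; last by rewrite (negPf (ndev k)).
  apply: simple_regret_le => b.
  have close a := mu_hat_close d (fun s => ndev (a, s)).
  have := close b; have := close (out h); have := outP h b.
  by rewrite !ltr_norml => ? /andP[? ?] /andP[? ?]; lra.
apply: (@le_trans _ _ (\sum_h history_law (@observe M B) h *
    (2 * eps + \sum_(k : arm M * bool) (deviates k.1 k.2 h)%:R))).
  by apply: ler_sum => h _; rewrite ler_wpM2l ?history_law_ge0.
under eq_bigr do rewrite mulrDr mulr_sumr.
rewrite big_split /= -mulr_suml sum_history_law mul1r lerD2l exchange_big /=.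
apply: (@le_trans _ _ (\sum_(k : arm M * bool) expR (- (B%:R * pmin I * eps ^+ 2 / 32)))).
  apply: ler_sum => -[a s] _; apply: le_trans (deviates_le a s eps0 eps1 p0).
  rewrite [X in _ <= X]big_mkcond /=; apply: ler_sum => h _.
  by case: deviates; rewrite ?mulr1 ?mulr0.
(* The union bound has 2M + 1 arms times 2 signs. *)
rewrite sumr_const card_prod card_option card_prod card_ord card_bool.
rewrite -[X in X <= _]mulr_natl.
by rewrite natrM -addn1 natrD natrM le_eqVlt; apply/orP; left; apply/eqP; ring.
Qed.

Lemma expected_regret_le1 (out : history I B -> arm M) : expected_regret out <= 1.
Proof.
rewrite -(sum_history_law B); apply: ler_sum => h _.
by rewrite ler_piMr ?simple_regret_le1 ?history_law_ge0.
Qed.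

End Play.
End Bandit.

(** * Choice of the accuracy and the final bound *)

Theorem theorem1 (R : realType) (kappa : R) (kappa_gt1 : 1 < kappa) :
  exists C : R, 0 < C /\
    forall (M : nat) (I : causal_bandit R M) (B : nat) (d : R)
      (out : history I B -> arm M),
      highest_empirical_mean d out ->
      0 < pmin I ->
      kappa <= pmin I * M%:R * B%:R ->
      expected_regret out <=
        C * Num.sqrt (1 / (pmin I * B%:R) * ln (pmin I * M%:R * B%:R)).
Proof.
have lnk : 0 < ln kappa by rewrite ln_gt0.
(* The constant splits as 2 eps + eps / ln kappa with eps = 8 sqrt v; the second summand pays for
   the tail term. *)
exists (8 * (2 + (ln kappa)^-1)); split.
  by rewrite mulr_gt0 // addr_gt0 ?invr_gt0.
move=> M I B d out outP p_gt0 le_kappa.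
set p := pmin I in p_gt0 le_kappa *.
set m : R := p * M%:R * B%:R in le_kappa *.
have m_gt1 : 1 < m by apply: lt_le_trans le_kappa.
have m_gt0 : 0 < m by apply: lt_trans m_gt1.
have M_gt0 : (0 < M)%N.
  by rewrite lt0n; apply: contraTneq m_gt0 => M0; rewrite /m M0 mulr0 mul0r ltxx.
have B_gt0 : (0 < B)%N.
  by rewrite lt0n; apply: contraTneq m_gt0 => B0; rewrite /m B0 mulr0 ltxx.
have MR : 1 <= M%:R :> R by rewrite ler1n.
have BR : 0 < B%:R :> R by rewrite ltr0n.
have pB_gt0 : 0 < p * B%:R by rewrite mulr_gt0.
have lnm : ln kappa <= ln m by rewrite ler_ln ?posrE // (lt_trans ltr01).
set v := 1 / (p * B%:R) * ln m.
have v_gt0 : 0 < v by rewrite mulr_gt0 ?divr_gt0 // (lt_le_trans lnk).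
pose eps := 8 * Num.sqrt v.
have eps0 : 0 <= eps by rewrite mulr_ge0 ?sqrtr_ge0.
have eps2 : eps ^+ 2 = 64 * v by rewrite exprMn sqr_sqrtr ?ltW //; ring.
have -> : 8 * (2 + (ln kappa)^-1) * Num.sqrt v = 2 * eps + eps / ln kappa.
  by rewrite /eps; ring.
have eps_lnk : 0 <= eps / ln kappa by rewrite divr_ge0 // ltW.
have [eps1|eps1] := leP eps 1; last first.
  by apply: le_trans (expected_regret_le1 _) _; lra.
apply: le_trans (expected_regret_le outP eps0 eps1 (ltW p_gt0)) _.
rewrite lerD2l -/p.
(* The 64 in [eps ^+ 2] against the 32 of the tail bound leaves the factor m^-2. *)
have -> : - (B%:R * p * eps ^+ 2 / 32) = - ln m + - ln m.
  by rewrite eps2 /v; field; rewrite !gt_eqF.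
rewrite expRD expRN lnK ?posrE //.
(* One factor 1 / m turns 6 M into 6 / (p B); the other is at most 1. *)
apply: (@le_trans _ _ (6 / (p * B%:R))).
  have -> : 6 / (p * B%:R) = 6 * M%:R / m.
    by rewrite /m; field; rewrite !gt_eqF // (lt_le_trans ltr01).
  rewrite mulrA ler_pM2r ?invr_gt0 // ler_pdivrMr //; nra.
rewrite ler_pdivlMr //.
apply: (@le_trans _ _ (6 * v)).
  have -> : 6 * v = 6 / (p * B%:R) * ln m by rewrite /v; ring.
  by rewrite ler_wpM2l // divr_ge0 // ltW.
(* As [eps <= 1], 6 v = 6 eps^2 / 64 <= eps. *)
nra.
Qed.
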